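(* The hyperspaces $\mathcal K$, $\mathcal K_P$, and $\mathcal K_T$ are arcwise connected.
   Context: For a space $X$, $C(X)$ denotes the hyperspace of all nonempty continua (compact connected subsets) in $X$ with the Vietoris topology, whose basic open sets are $\langle U_1,\dots,U_n\rangle=\{C\in C(X): C\subset\bigcup_{k=1}^n U_k \text{ and } U_k\cap C\neq\emptyset \text{ for all } k\}$, with $n\in\mathbb N$ and $U_k$ open in $X$ (equivalently, for $X=\mathbb R^n$, the topology of the Hausdorff distance). $\mathcal K\subset C(\mathbb R^3)$ is the hyperspace of all knots, i.e. of all simple closed curves (homeomorphic copies of the circle) in $\mathbb R^3$. $\mathcal K_P\subset\mathcal K$ is the hyperspace of polygonal knots (knots that are finite unions of straight line segments). A knot $C$ is tame if there is a homeomorphism of $\mathbb R^3$ onto itself mapping $C$ onto a polygonal knot. $\mathcal K_T\subset\mathcal K$ is the hyperspace of tame knots. All carry the subspace topology. *)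

(* Defs.v *)
From HB Require Import structures.
From mathcomp Require Import all_boot all_order all_algebra.
From mathcomp Require Import all_classical all_reals all_analysis.
Import Order.TTheory GRing.Theory Num.Theory.
Import numFieldNormedType.Exports.

Set Implicit Arguments.
Unset Strict Implicit.
Unset Printing Implicit Defensive.

Local Open Scope classical_set_scope.
Local Open Scope ring_scope.

Record continuum (X : topologicalType) := Continuum {
  carrier :> set X;
  continuum_nonempty : carrier !=set0;
  continuum_compact : compact carrier;
  continuum_connected : connected carrier }.

Lemma carrier_inj (X : topologicalType) : injective (@carrier X).
Proof.
move=> [A A0 Ac Aconn] [B B0 Bc Bconn] /= AB; subst B.
by congr Continuum; exact: Prop_irrelevance.
Qed.

HB.instance Definition _ (X : topologicalType) := gen_eqMixin (continuum X).
HB.instance Definition _ (X : topologicalType) := gen_choiceMixin (continuum X).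

Section vietoris.
Variable X : topologicalType.

Definition vietoris_box (n : nat) (U : 'I_n -> set X) : set (continuum X) :=
  [set C : continuum X |
    C `<=` \bigcup_k U k /\ forall k, U k `&` C !=set0].

Definition vietoris_base : set (set (continuum X)) :=
  [set W | exists n (U : 'I_n -> set X),
    (forall k, open (U k)) /\ W = vietoris_box U].

Let vietoris_cover : \bigcup_(W in vietoris_base) W = setT.
Proof.
apply/seteqP; split => // C _.
exists (@vietoris_box 1 (fun=> setT)).
  by exists 1%N, (fun=> setT); split => // _; exact: openT.
split; first by move=> x _; exists ord0.
by move=> _; rewrite setTI; exact: continuum_nonempty.
Qed.

Let vietoris_join (V W : set (continuum X)) (C : continuum X) :
  vietoris_base V -> vietoris_base W -> V C -> W C ->
  exists Z, [/\ vietoris_base Z, Z C & Z `<=` V `&` W].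
Proof.
move=> [m [U [oU ->]]] [n [U' [oU' ->]]] [CU UC] [CU' UC'].
pose Q (k : 'I_(m + n)) := match fintype.split k with
  | inl i => U i `&` \bigcup_j U' j
  | inr j => (\bigcup_i U i) `&` U' j
  end.
have Ql i : Q (unsplit (inl i)) = U i `&` \bigcup_j U' j.
  by rewrite /Q unsplitK.
have Qr j : Q (unsplit (inr j)) = (\bigcup_i U i) `&` U' j.
  by rewrite /Q unsplitK.
exists (vietoris_box Q); split.
- exists (m + n)%N, Q; split => // k; rewrite /Q.
  by case: (fintype.split k) => i; apply: openI => //; apply: bigcup_open.
- split=> [x Cx|k].
    have [i _ Uix] := CU x Cx.
    by exists (unsplit (inl i)) => //; rewrite Ql; split => //; exact: CU'.
  rewrite /Q; case: (fintype.split k) => i.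
    by have [x [Ux Cx]] := UC i; exists x; do !split => //; exact: CU'.
  by have [x [Ux Cx]] := UC' i; exists x; do !split => //; exact: CU.
- move=> D [DQ QD]; split; split.
  + move=> x /DQ [k _]; rewrite /Q; case: (fintype.split k) => i [] //.
    by move=> Ux _; exists i.
  + move=> i; have [x [+ Dx]] := QD (unsplit (inl i)).
    by rewrite Ql => -[Ux _]; exists x.
  + move=> x /DQ [k _]; rewrite /Q; case: (fintype.split k) => i [] //.
    by move=> _ Ux; exists i.
  + move=> i; have [x [+ Dx]] := QD (unsplit (inr i)).
    by rewrite Qr => -[_ Ux]; exists x.
Qed.

HB.instance Definition _ := isBaseTopological.Build (continuum X)
  vietoris_cover vietoris_join.

End vietoris.

Lemma open_vietoris (X : topologicalType) (W : set (continuum X)) :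
  open W <-> exists2 D : set (set (continuum X)),
    D `<=` @vietoris_base X & W = \bigcup_(V in D) V.
Proof. by split=> [[D sD <-]|[D sD ->]]; exists D. Qed.

Definition homeomorphism_on (S T : topologicalType) (A : set S) (B : set T)
    (f : S -> T) : Prop :=
  exists g : T -> S,
    [/\ {within A, continuous f}, {within B, continuous g},
        f @` A = B, g @` B = A & {in A, cancel f g}].

(* An arc J from x to y is a homeomorphic copy of [0, 1]; taking it inside A
   expresses arcwise connectedness of A with the subspace topology. *)
Definition arcwise_connected (R : realType) (T : topologicalType) (A : set T)
  : Prop :=
  forall x y : T, A x -> A y -> x <> y ->
    exists (J : set T) (f : R -> T),
      [/\ J `<=` A, homeomorphism_on (`[0, 1] : set R) J f, f 0 = x & f 1 = y].

Section knots.
Variable R : realType.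

(* 'rV[R]_3 carries the max norm, hence the usual topology of R^3. *)

Definition circle : set (R * R)%type := [set p | p.1 ^+ 2 + p.2 ^+ 2 = 1].

Definition is_knot (C : set 'rV[R]_3) : Prop :=
  exists f : R * R -> 'rV[R]_3, homeomorphism_on circle C f.

Definition segment (a b : 'rV[R]_3) : set 'rV[R]_3 :=
  [set (1 - t) *: a + t *: b | t in (`[0, 1] : set R)].

Definition is_polygonal_knot (C : set 'rV[R]_3) : Prop :=
  is_knot C /\ exists s : seq ('rV[R]_3 * 'rV[R]_3),
    C = \bigcup_(ab in [set` s]) segment ab.1 ab.2.

Definition is_tame_knot (C : set 'rV[R]_3) : Prop :=
  is_knot C /\ exists h : 'rV[R]_3 -> 'rV[R]_3,
    homeomorphism_on setT setT h /\ is_polygonal_knot (h @` C).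

Definition knots : set (continuum 'rV[R]_3) := [set C | is_knot C].

Definition polygonal_knots : set (continuum 'rV[R]_3) :=
  [set C | is_polygonal_knot C].

Definition tame_knots : set (continuum 'rV[R]_3) := [set C | is_tame_knot C].

End knots.

Arguments knots R : clear implicits.
Arguments polygonal_knots R : clear implicits.
Arguments tame_knots R : clear implicits.

(* Main.v *)
Require Import Defs.
From mathcomp Require Import all_boot all_order all_algebra.
From mathcomp Require Import all_classical all_reals all_analysis.
From mathcomp Require Import ring lra.
Import Order.TTheory GRing.Theory Num.Theory.
Import numFieldNormedType.Exports.

(* Every knot C can be deformed to a standard quadrilateral by piecewise linear
   homeomorphisms of the space that degenerate in the limit. Choose a coordinate
   x of positive extent on C, let xi be the affine function of x with
   xi(C) = [-1, 1], and let c(y, xi) be xi truncated to [-h, h], where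
   h = max(0, 1 - y). At time t, (x, y, z) is moved to (X, Y, Z) with
     Y = (1 - t) y + t |xi|,  X = (1 - t) x + t c(Y, xi),  Z = (1 - t) z + t M.
   For t < 1 this is a piecewise linear homeomorphism, hence preserves knots,
   polygonal knots and tame knots; at t = 1 it only depends on xi and maps C onto
   the quadrilateral |X| + |Y - 1/2| = 1/2 in the plane Z = M, however wild C is.
   Continuity in the Vietoris topology follows from joint continuity and
   compactness. If M differs from the maximum of z on C, then max Z is strictly
   monotone in t, so the path is injective. Being joined by an injective path is
   transitive in Hausdorff spaces, and the quadrilaterals for different
   coordinates and heights are joined to each other by the same deformation. *)

Set Implicit Arguments.
Unset Strict Implicit.
Unset Printing Implicit Defensive.

Local Open Scope classical_set_scope.
Local Open Scope ring_scope.

(** * The Vietoris topology and injective paths *)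

Section image_continuum.
Variables (X Y : topologicalType) (f : X -> Y).
Hypothesis cf : continuous f.
Variable C : continuum X.

Lemma image_continuum_nonempty : f @` C !=set0.
Proof. exact/image_nonempty/continuum_nonempty. Qed.

Lemma image_continuum_compact : compact (f @` C).
Proof.
apply: continuous_compact; last exact: continuum_compact.
exact: continuous_subspaceT.
Qed.

Lemma image_continuum_connected : connected (f @` C).
Proof.
apply: connected_continuous_connected; first exact: continuum_connected.
exact: continuous_subspaceT.
Qed.

Definition image_continuum : continuum Y :=
  Continuum image_continuum_nonempty image_continuum_compact
    image_continuum_connected.

End image_continuum.

Lemma vietoris_box_open (X : topologicalType) (n : nat) (U : 'I_n -> set X) :
  (forall k, open (U k)) -> open (vietoris_box U).
Proof.
move=> oU; apply/open_vietoris; exists [set vietoris_box U]; last first.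
  by rewrite bigcup_set1.
by move=> _ ->; exists n, U.
Qed.

Lemma continuous_pair_r (S T U : topologicalType) (F : S * T -> U) (s : S) :
  continuous F -> continuous (fun t => F (s, t)).
Proof.
move=> cF t; apply: (@continuous_comp _ _ _ (fun t => (s, t)) F); last exact: cF.
by apply: cvg_pair; [exact: cvg_cst | exact: cvg_id].
Qed.

Arguments continuous_pair_r {S T U F} s cF.

(** Compactness of [C] turns the neighbourhoods given by joint continuity at single points into one
    neighbourhood of [t] valid for all of [C], which handles containment in the box. Meeting its
    finitely many members needs just one point of [C] per member. *)
Lemma vietoris_continuous (T X Y : topologicalType) (F : T * X -> Y)
    (cF : continuous F) (C : continuum X) :
  continuous (fun t => image_continuum (continuous_pair_r t cF) C).
Proof.
apply/continuousP => W /open_vietoris[D sD ->].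
rewrite preimage_bigcup; apply: bigcup_open => V /sD[n [U [oU ->]]].
rewrite openE => t [/= sub meet].
have cov : \forall t' \near t,
    (C : set X) `<=` [set p | (\bigcup_k U k) (F (t', p))].
  have /compact_near_coveringP/(_ T (nbhs t)) := @continuum_compact _ C.
  apply=> p Cp; have : nbhs (F (t, p)) (\bigcup_k U k).
    apply: open_nbhs_nbhs; split; first exact: bigcup_open.
    by apply: sub; exists p.
  move/(cF (t, p)) => [[A B] /= [At Bp] AB]; exists (B, A) => //= -[q t'] /= [Bq At'].
  exact: (AB (t', q)).
have hit : \forall t' \near t, forall k, exists2 p, carrier C p & U k (F (t', p)).
  apply: filter_forall => k.
  have [y [Uk [p Cp Fp]]] := meet k; rewrite -{y}Fp in Uk.
  have : nbhs (F (t, p)) (U k) by exact: open_nbhs_nbhs.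
  move/(cF (t, p)) => [[A B] /= [At Bp] AB].
  apply: filterS At => t' At'; exists p => //; apply: (AB (t', p)).
  by split => //; exact: nbhs_singleton Bp.
apply: filterS2 cov hit => t' covt' hitt'; split=> [_ [p Cp <-]|k] /=.
  exact: covt'.
by have [p Cp Up] := hitt' k; exists (F (t', p)); split => //; exists p.
Qed.

(** A point [x] of [C] outside [D] is separated from the closed set [D] by disjoint open sets [A]
    and [B], by regularity. Meeting [A] and lying inside [B] are then incompatible open conditions
    on a continuum. *)
Lemma vietoris_hausdorff (X : topologicalType) :
  hausdorff_space X -> regular_space X -> hausdorff_space (continuum X).
Proof.
move=> hX rX; rewrite open_hausdorff.
have sep (C D : continuum X) x : carrier C x -> ~ carrier D x ->
    exists U V : set (continuum X), [/\ open U, open V, U C, V D & U `&` V = set0].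
  move=> Cx Dx.
  have clD := compact_closed hX (@continuum_compact _ D).
  have [A [B [oA oB Ax DB AB]]] := (regular_openP x).1 (rX x) _ clD Dx.
  (* The second member [setT] makes the containment condition void, so this box consists of the
     continua that meet [A]. *)
  exists (vietoris_box (fun k : 'I_2 => if k == ord0 then A else setT)),
    (vietoris_box (fun _ : 'I_1 => B)); split.
  - by apply: vietoris_box_open => k; case: ifP => _ //; exact: openT.
  - exact: vietoris_box_open.
  - split=> [y Cy|k]; first by exists ord_max.
    by exists x; case: ifP.
  - split=> [y Dy|k]; first by exists ord0 => //; exact: DB.
    have [y Dy] := continuum_nonempty D.
    by exists y; split => //; exact: DB.
  - apply/seteqP; split=> // E [[_ /(_ ord0)]] /= [y [Ay Ey]] [/(_ y Ey)[k _ By] _].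
    by have : (A `&` B) y by []; rewrite AB.
move=> C D /eqP CD.
have [[x Cx Dx]|[x Dx Cx]] : (exists2 x, carrier C x & ~ carrier D x) \/
    (exists2 x, carrier D x & ~ carrier C x).
  apply: contrapT => /not_orP[/forall2NP CnD /forall2NP DnC]; apply: CD.
  apply/carrier_inj/seteqP; split=> x.
    by case: (CnD x) => // /contrapT.
  by case: (DnC x) => // /contrapT.
- have [U [V [oU oV UC VD UV]]] := sep _ _ _ Cx Dx.
  by exists (U, V) => /=; [rewrite !inE|split=> //; apply/eqP].
- have [U [V [oU oV UC VD UV]]] := sep _ _ _ Dx Cx.
  by exists (V, U) => /=; [rewrite !inE|split=> //; apply/eqP; rewrite setIC].
Qed.

Section arcs.
Variables (R : realType) (T : topologicalType) (A : set T).
Hypothesis hT : hausdorff_space T.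

Let I : set R := `[0, 1].

Definition arc_joined (x y : T) : Prop :=
  x = y \/ exists f : R -> T, [/\ continuous f,
    {in I &, injective f}, f @` I `<=` A, f 0 = x & f 1 = y].

(** Closed subsets of the compact interval have compact, hence closed, images in the Hausdorff space
    [T]; therefore the inverse is continuous. *)
Lemma injective_homeomorphism_on (f : R -> T) :
  continuous f -> {in I &, injective f} -> homeomorphism_on I (f @` I) f.
Proof.
move=> cf fI.
have [g fK] : exists g : T -> R, {in I, cancel f g}.
  by exists ('pinv_(fun=> 0) I f); exact: pinvKV.
exists g; split => //.
- exact: continuous_subspaceT.
- apply/continuous_closedP => B cB.
  apply/closed_subspaceP; exists (f @` (I `&` B)).
    apply: compact_closed => //; apply: continuous_compact.
      exact: continuous_subspaceT.
    by apply: compact_closedI => //; exact: segment_compact.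
  apply/seteqP; split=> y.
    move=> [[t [It Bt] <-] fIt]; split; last by exists t.
    by change (B (g (f t))); rewrite fK ?inE.
  move=> [Bgy [t It ty]]; have Bt : B t.
    by rewrite -[t]fK ?inE // ty; exact: Bgy.
  rewrite -ty; by split; exists t.
- apply/seteqP; split=> [_ [_ [t It <-] <-]|t It]; first by rewrite fK ?inE.
  by exists (f t); [exists t|rewrite fK ?inE].
Qed.

Lemma arc_joined_connected :
  (forall x y, A x -> A y -> arc_joined x y) -> arcwise_connected R A.
Proof.
move=> joined x y Ax Ay xy; have [//|[f [cf fI fA f0 f1]]] := joined x y Ax Ay.
by exists (f @` I), f; split => //; exact: injective_homeomorphism_on.
Qed.

Lemma arc_joined_sym x y : arc_joined x y -> arc_joined y x.
Proof.
move=> [->|[f [cf fI fA f0 f1]]]; [by left|right].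
have I1B t : I t -> I (1 - t) by rewrite /I /= !in_itv /= => /andP[? ?]; lra.
exists (fun t => f (1 - t)); split.
- move=> t; apply: continuous_comp; last exact: cf.
  by apply: cvgB; [exact: cvg_cst|exact: cvg_id].
- by move=> s t; rewrite !inE => /I1B Is /I1B It /(fI _ _ (mem_set Is) (mem_set It)); lra.
- by move=> _ [t /I1B It <-]; apply: fA; exists (1 - t).
- by rewrite subr0.
- by rewrite subrr.
Qed.

(* The first path is followed until it first hits the second one. *)
Lemma arc_joined_trans y x z :
  arc_joined x y -> arc_joined y z -> arc_joined x z.
Proof.
move=> [->//|[f [cf fI fA f0 f1]]] [<-|[g [cg gI gA g0 g1]]].
  by right; exists f.
have [->|xz] := pselect (x = z); [by left|right].
have segP (t : R) : I t <-> 0 <= t <= 1 by rewrite /I /= in_itv.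
pose S := I `&` f @^-1` (g @` I).
have cS : compact S.
  apply: compact_closedI; first exact: segment_compact.
  apply: preimage_closed => //; apply: compact_closed => //.
  by apply: continuous_compact; [exact: continuous_subspaceT|exact: segment_compact].
have [s [/segP Is [r /segP Ir gr]] smin] :
    exists2 s, S s & forall t, S t -> s <= t.
  have : S !=set0.
    exists 1; split; first by apply/segP; rewrite ler01 lexx.
    by exists 0; [apply/segP; rewrite ler01 lexx|rewrite g0].
  move=> /compact_EVT_min/(_ cS)/(_ (@continuous_subspaceT _ _ _ id (fun=> cvg_id))).
  by move=> [s /set_mem Ss sS]; exists s => // t St; apply: sS; rewrite inE.
(* The duration of the joined path: [s] along [f], then [1 - r] along [g]. It vanishes only for
   [s = 0] and [r = 1], which would give [x = z]. *)
pose L := s + (1 - r).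
have L_gt0 : 0 < L.
  rewrite lt_neqAle; apply/andP; split; last by rewrite /L; lra.
  apply/eqP => L0; apply: xz.
  have [s0 r1] : s = 0 /\ r = 1 by rewrite /L in L0; lra.
  by rewrite -f0 -g1 -s0 -r1 gr.
pose h u := if u <= s then f u else g (u - s + r).
have ch : continuous h.
  have cgs : continuous (fun u => g (u - s + r)).
    move=> u; apply: continuous_comp; last exact: cg.
    by apply: cvgD; [apply: cvgB; [exact: cvg_id|exact: cvg_cst]|exact: cvg_cst].
  rewrite continuous_subspace_setT -(_ : `]-oo, s] `|` `[s, +oo[ = setT); last first.
    apply/seteqP; split=> // u _ /=; rewrite !in_itv /= andbT.
    by case: (leP u s) => ?; [left|right; exact: ltW].
  apply: withinU_continuous.
  - by rewrite set_itvE; exact: closed_le.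
  - by rewrite set_itvE; exact: closed_ge.
  - apply: (@subspace_eq_continuous _ _ _ f); last exact: continuous_subspaceT.
    by move=> u; rewrite inE /= in_itv /from_subspace /h /= => ->.
  - apply: (@subspace_eq_continuous _ _ _ (fun u => g (u - s + r))).
      move=> u; rewrite inE /= in_itv /from_subspace /h /= andbT => su.
      by case: ifP => // us; rewrite (_ : u = s) ?subrr ?add0r //; lra.
    exact: continuous_subspaceT.
have hL u v : 0 <= u -> u < v -> v <= L -> h u <> h v.
  rewrite /h => u0 uv vL; case: ifPn => us; case: ifPn => vs.
  - by move/fI; rewrite !inE !segP /L in vL *; move=> /(_ _ _)/eqP; lra.
  (* If the two pieces meet, [u] is a hitting time, so [u = s] by minimality; injectivity of [g]
     then yields [v = s], contrary to [v > s]. *)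
  - move=> fug; have Iv : I (v - s + r) by apply/segP; rewrite /L in vL; lra.
    have us' : s <= u.
      apply: smin; split; first by apply/segP; lra.
      by exists (v - s + r).
    have us'' : u = s by lra.
    have : r = v - s + r by apply: gI; rewrite ?inE ?segP // gr -fug us''.
    by lra.
  - by move: us => /negP []; lra.
  - move/gI; rewrite !inE !segP /L in vL *.
    by move=> H; have := H ltac:(lra) ltac:(lra); lra.
have I_L t : I t -> 0 <= L * t <= L.
  by move=> /segP ?; apply/andP; split; nra.
exists (fun t => h (L * t)); split.
- move=> t; apply: continuous_comp; last exact: ch.
  exact: mulrl_continuous.
- move=> t u /set_mem/I_L/andP[t0 tL] /set_mem/I_L/andP[u0 uL] htu.
  have [tu|ut|] := ltgtP (L * t) (L * u).
  + by case: (hL _ _ t0 tu uL).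
  + by case: (hL _ _ u0 ut tL).
  + by move/mulfI; apply; rewrite gt_eqF.
- move=> _ [t /I_L /andP[t0 tL] <-]; rewrite /h; case: ifPn => ts.
    by apply: fA; exists (L * t) => //; apply/segP; lra.
  by apply: gA; exists (L * t - s + r) => //; apply/segP; rewrite /L in tL ts *; lra.
- by rewrite mulr0 /h; have /andP[-> _] := Is.
- rewrite mulr1 /h /L; case: ifPn => Ls; last by rewrite -[RHS]g1; congr g; lra.
  have r1 : r = 1 by lra.
  by rewrite -g1 -r1 gr r1 subrr addr0.
Qed.

End arcs.

(** * Truncation and coordinates *)

Section pointwise_continuity.
Variables (R : realType) (T : topologicalType).
Implicit Types f g : T -> R.

Lemma continuous_addr f g :
  continuous f -> continuous g -> continuous (fun t => f t + g t).
Proof. by move=> cf cg t; apply: cvgD; [exact: cf|exact: cg]. Qed.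

Lemma continuous_subr f g :
  continuous f -> continuous g -> continuous (fun t => f t - g t).
Proof. by move=> cf cg t; apply: cvgB; [exact: cf|exact: cg]. Qed.

Lemma continuous_mulr f g :
  continuous f -> continuous g -> continuous (fun t => f t * g t).
Proof. by move=> cf cg t; apply: cvgM; [exact: cf|exact: cg]. Qed.

Lemma continuous_normr f : continuous f -> continuous (fun t => `|f t|).
Proof. by move=> cf t; apply: cvg_norm; exact: cf. Qed.

Lemma continuous_maxr f g :
  continuous f -> continuous g -> continuous (fun t => Num.max (f t) (g t)).
Proof. by move=> cf cg t; apply: continuous_max; [exact: cf|exact: cg]. Qed.

Lemma continuous_minr f g :
  continuous f -> continuous g -> continuous (fun t => Num.min (f t) (g t)).
Proof. by move=> cf cg t; apply: continuous_min; [exact: cf|exact: cg]. Qed.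

Lemma continuous_invr f :
  continuous f -> (forall t, f t != 0) -> continuous (fun t => (f t)^-1).
Proof. by move=> cf f0 t; apply: cvgV; [exact: f0|exact: cf]. Qed.

Lemma continuous_pairr f g :
  continuous f -> continuous g -> continuous (fun t => (f t, g t)).
Proof.
move=> cf cg t.
exact: (@cvg_pair _ _ _ (nbhs t) (nbhs (f t)) (nbhs (g t)) _ _ _ f g (cf t) (cg t)).
Qed.

Lemma continuous_cst (c : R) : continuous (fun _ : T => c).
Proof. by move=> t; exact: cvg_cst. Qed.

End pointwise_continuity.

Section coordinates.
Variable R : realType.

(** Addition in ['I_3] is cyclic, so [i], [i + 1], [i + 2] run through all coordinates and one
    construction serves every choice of the axis [i]. *)
Definition point (i : 'I_3) (x y z : R) : 'rV[R]_3 :=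
  x *: delta_mx 0 i + y *: delta_mx 0 (i + 1) + z *: delta_mx 0 (i + 2).

Lemma point_coordE i x y z j : point i x y z 0 j =
  x * (j == i)%:R + y * (j == i + 1)%:R + z * (j == i + 2)%:R.
Proof.
have dE a k : (a *: delta_mx 0 k : 'rV[R]_3) 0 j = a * (j == k)%:R.
  by rewrite mxE [X in _ * X]mxE eqxx.
by rewrite /point mxE [X in X + _]mxE !dE.
Qed.

Lemma ord3_neq (i : 'I_3) :
  [/\ i != i + 1, i != i + 2 & i + 1 != i + 2].
Proof.
by split; rewrite ?(inj_eq (addrI i)) // -[X in X != _]addr0 (inj_eq (addrI i)).
Qed.

Lemma point_coord0 i x y z : point i x y z 0 i = x.
Proof.
have [i1 i2 _] := ord3_neq i.
by rewrite point_coordE eqxx (negPf i1) (negPf i2) !mulr0 !addr0 mulr1.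
Qed.

Lemma point_coord1 i x y z : point i x y z 0 (i + 1) = y.
Proof.
have [i1 _ i12] := ord3_neq i.
by rewrite point_coordE eqxx eq_sym (negPf i1) (negPf i12) !mulr0 add0r addr0 mulr1.
Qed.

Lemma point_coord2 i x y z : point i x y z 0 (i + 2) = z.
Proof.
have [_ i2 i12] := ord3_neq i; rewrite point_coordE eqxx eq_sym (negPf i2) eq_sym.
by rewrite (negPf i12) !mulr0 !add0r mulr1.
Qed.

Definition point_coord := (point_coord0, point_coord1, point_coord2).

Lemma ord3_cases (i j : 'I_3) : [\/ j = i, j = i + 1 | j = i + 2].
Proof.
rewrite -[j](subrK i) ![_ + i]addrC.
case: (j - i) => [[|[|[|//]]] k3]; [constructor 1|constructor 2|constructor 3].
- by rewrite -[RHS]addr0; congr (_ + _); exact: val_inj.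
- by congr (_ + _); exact: val_inj.
- by congr (_ + _); exact: val_inj.
Qed.

Lemma coord_ext (i : 'I_3) (p q : 'rV[R]_3) :
  p 0 i = q 0 i -> p 0 (i + 1) = q 0 (i + 1) -> p 0 (i + 2) = q 0 (i + 2) ->
  p = q.
Proof. by move=> p0 p1 p2; apply/rowP => j; case: (ord3_cases i j) => ->. Qed.

Lemma point_eta i (p : 'rV[R]_3) : point i (p 0 i) (p 0 (i + 1)) (p 0 (i + 2)) = p.
Proof. by apply: (coord_ext (i := i)); rewrite point_coord. Qed.

Lemma continuous_point (T : topologicalType) i (x y z : T -> R) :
  continuous x -> continuous y -> continuous z ->
  continuous (fun t => point i (x t) (y t) (z t)).
Proof.
move=> cx cy cz t; rewrite /point.
by apply: cvgD; [apply: cvgD|]; apply: cvgZr_tmp; [exact: cx|exact: cy|exact: cz].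
Qed.

Lemma continuous_coord j : continuous (fun p : 'rV[R]_3 => p 0 j).
Proof. exact: coord_continuous. Qed.

End coordinates.

Section clamp.
Variable R : realType.
Implicit Types h v : R.

Definition clamp h v : R := Num.max (- h) (Num.min h v).

Variant clamp_spec h v : R -> Prop :=
| ClampLow of v <= - h : clamp_spec h v (- h)
| ClampMid of - h <= v & v <= h : clamp_spec h v v
| ClampHigh of h <= v : clamp_spec h v h.

Lemma clampP h v : 0 <= h -> clamp_spec h v (clamp h v).
Proof.
move=> h0; rewrite /clamp; case: (leP h v) => hv.
  by rewrite max_r; [exact: ClampHigh|lra].
by case: (leP (- h) v) => vh; [apply: ClampMid; lra|apply: ClampLow; exact: ltW].
Qed.

Lemma continuous_clamp (T : topologicalType) (h v : T -> R) :
  continuous h -> continuous v -> continuous (fun t => clamp (h t) (v t)).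
Proof.
move=> ch cv; apply: continuous_maxr; last exact: continuous_minr.
by move=> t; apply: cvgN; exact: ch.
Qed.

Lemma clamp_low h v : 0 <= h -> v <= - h -> clamp h v = - h.
Proof. by move=> h0; case: clampP => // *; lra. Qed.

Lemma clamp_mid h v : 0 <= h -> - h <= v <= h -> clamp h v = v.
Proof. by move=> h0; case: clampP => // *; lra. Qed.

Lemma clamp_high h v : 0 <= h -> h <= v -> clamp h v = h.
Proof. by move=> h0; case: clampP => // *; lra. Qed.

(* These two lemmas say that v |-> (a v + b clamp h v) / (a + b) and
   w |-> ((a + b) w - b clamp h w) / a are inverse to each other. *)
Lemma clamp_interpolate a b h v w : 0 < a -> 0 <= b -> 0 <= h ->
  (a + b) * w = a * v + b * clamp h v -> clamp h w = clamp h v.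
Proof.
move=> a0 b0 h0; have ab0 : 0 < a + b by lra.
case: (clampP v h0) => [vh|hv vh|hv] E.
- apply: clamp_low => //; rewrite -(ler_pM2l ab0) E.
  by have : a * v <= a * - h; [rewrite ler_pM2l|lra].
- have -> : w = v by apply: (mulfI (lt0r_neq0 ab0)); rewrite E; ring.
  by apply: clamp_mid => //; apply/andP.
- apply: clamp_high => //; rewrite -(ler_pM2l ab0) E.
  by have : a * h <= a * v; [rewrite ler_pM2l|lra].
Qed.

Lemma clamp_extrapolate a b h v w : 0 < a -> 0 <= b -> 0 <= h ->
  (a + b) * w = a * v + b * clamp h w -> clamp h v = clamp h w.
Proof.
move=> a0 b0 h0; have ab0 : 0 < a + b by lra.
case: (clampP w h0) => [wh|hw wh|hw] E.
- apply: clamp_low => //; rewrite -(ler_pM2l a0).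
  by have : (a + b) * w <= (a + b) * - h; [rewrite ler_pM2l|lra].
- have -> : v = w by apply: (mulfI (lt0r_neq0 a0)); lra.
  by apply: clamp_mid => //; apply/andP.
- apply: clamp_high => //; rewrite -(ler_pM2l a0).
  by have : (a + b) * h <= (a + b) * w; [rewrite ler_pM2l|lra].
Qed.

Definition tent (y : R) : R := Num.max 0 (1 - y).

Lemma tent_ge0 y : 0 <= tent y. Proof. by rewrite /tent le_max lexx. Qed.

Lemma continuous_tent (T : topologicalType) (y : T -> R) :
  continuous y -> continuous (fun t => tent (y t)).
Proof.
move=> cy; apply: continuous_maxr; first exact: continuous_cst.
by apply: continuous_subr => //; exact: continuous_cst.
Qed.

End clamp.

(** * The deformation *)

Section collapse.
Variables (R : realType) (i : 'I_3) (x0 r M : R).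
Hypothesis r_gt0 : 0 < r.

Let r_neq0 : r != 0. Proof. exact: lt0r_neq0. Qed.

Definition rescale (p : 'rV[R]_3) : R := (p 0 i - x0) / r.

(* At time [t < 1] this is a piecewise linear homeomorphism of the space; at
   time 1 it factors through [rescale] and maps [-1, 1] onto a quadrilateral. *)
Definition collapse (t : R) (p : 'rV[R]_3) : 'rV[R]_3 :=
  let y := (1 - t) * p 0 (i + 1) + t * `|rescale p| in
  point i ((1 - t) * p 0 i + t * clamp (tent y) (rescale p)) y
    ((1 - t) * p 0 (i + 2) + t * M).

(** The truncation level depends only on the second coordinate of the image, so it can be read off
    [q]. Here [w] is [(1 - t) * r * xi + t * clamp h xi]; divided by the sum of the weights it
    becomes a mean of [xi] and [clamp h xi], which has the same truncation as [xi]. Knowing that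
    truncation, one solves for [xi]. *)
Definition uncollapse (t : R) (q : 'rV[R]_3) : 'rV[R]_3 :=
  let w := q 0 i - (1 - t) * x0 in
  let xi := (w - t * clamp (tent (q 0 (i + 1))) (w / ((1 - t) * r + t)))
            / ((1 - t) * r) in
  point i (x0 + r * xi) ((q 0 (i + 1) - t * `|xi|) / (1 - t))
    ((q 0 (i + 2) - t * M) / (1 - t)).

Lemma collapse0 p : collapse 0 p = p.
Proof.
by rewrite /collapse !subr0 !mul0r !addr0 !mul1r; exact: point_eta.
Qed.

Lemma collapseK t : 0 <= t < 1 -> cancel (collapse t) (uncollapse t).
Proof.
move=> /andP[t0 t1] p; set xi := rescale p.
have pxi : p 0 i = x0 + r * xi by rewrite /xi /rescale; field.
have t1_neq0 : 1 - t != 0 by rewrite lt0r_neq0 // subr_gt0.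
have a_gt0 : 0 < (1 - t) * r by rewrite mulr_gt0 // subr_gt0.
have at_neq0 : (1 - t) * r + t != 0 by rewrite lt0r_neq0 // ltr_wpDr.
rewrite /uncollapse /collapse !point_coord -/xi.
set h := tent _; set w := _ - (1 - t) * x0.
have wE : w = (1 - t) * r * xi + t * clamp h xi by rewrite /w pxi; ring.
have -> : clamp h (w / ((1 - t) * r + t)) = clamp h xi.
  apply: (clamp_interpolate a_gt0 t0); first exact: tent_ge0.
  by rewrite -wE; field.
have -> : (w - t * clamp h xi) / ((1 - t) * r) = xi.
  by rewrite wE; field; apply/andP.
apply: (coord_ext (i := i)); rewrite point_coord //.
- by field.
- by field.
Qed.

Lemma uncollapseK t : 0 <= t < 1 -> cancel (uncollapse t) (collapse t).
Proof.
move=> /andP[t0 t1] q.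
have t1_neq0 : 1 - t != 0 by rewrite lt0r_neq0 // subr_gt0.
have a_gt0 : 0 < (1 - t) * r by rewrite mulr_gt0 // subr_gt0.
have at_neq0 : (1 - t) * r + t != 0 by rewrite lt0r_neq0 // ltr_wpDr.
rewrite /uncollapse; set w := q 0 i - _; set h := tent _.
set c := clamp h _; set xi := (w - _) / _.
have wE : w = (1 - t) * r * xi + t * c by rewrite /xi; field; apply/andP.
have cE : clamp h xi = c.
  apply: (clamp_extrapolate a_gt0 t0); first exact: tent_ge0.
  by rewrite -/c -wE; field.
rewrite /collapse /rescale !point_coord.
have -> : (x0 + r * xi - x0) / r = xi by field.
have -> : (1 - t) * ((q 0 (i + 1) - t * `|xi|) / (1 - t)) + t * `|xi| = q 0 (i + 1).
  by field.
rewrite -/h cE; apply: (coord_ext (i := i)); rewrite point_coord //.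
- by transitivity (w + (1 - t) * x0); [rewrite wE|rewrite /w]; ring.
- by field.
Qed.

Lemma continuous_collapse :
  continuous (fun tp : R * 'rV[R]_3 => collapse tp.1 tp.2).
Proof.
have ct : continuous (fun tp : R * 'rV[R]_3 => tp.1) by move=> ?; exact: cvg_fst.
have cp j : continuous (fun tp : R * 'rV[R]_3 => tp.2 0 j).
  move=> tp; apply: (@continuous_comp _ _ _ snd (fun p : 'rV[R]_3 => p 0 j)).
    exact: cvg_snd.
  exact: continuous_coord.
have cm (f : R * 'rV[R]_3 -> R) j : continuous f ->
    continuous (fun tp : R * 'rV[R]_3 => (1 - tp.1) * tp.2 0 j + tp.1 * f tp).
  move=> cf; apply: continuous_addr; apply: continuous_mulr => //.
  by apply: continuous_subr => //; exact: continuous_cst.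
have cxi : continuous (fun tp : R * 'rV[R]_3 => rescale tp.2).
  apply: continuous_mulr; last exact: continuous_cst.
  by apply: continuous_subr => //; exact: continuous_cst.
have cy := cm _ (i + 1) (continuous_normr cxi).
apply: continuous_point => //; apply: cm; last exact: continuous_cst.
by apply: continuous_clamp => //; exact: continuous_tent.
Qed.

Lemma continuous_uncollapse t : continuous (uncollapse t).
Proof.
have cp j : continuous (fun q : 'rV[R]_3 => q 0 j) by exact: continuous_coord.
have cw : continuous (fun q : 'rV[R]_3 => q 0 i - (1 - t) * x0).
  by apply: continuous_subr => //; exact: continuous_cst.
have cc : continuous (fun q : 'rV[R]_3 => clamp (tent (q 0 (i + 1)))
    ((q 0 i - (1 - t) * x0) / ((1 - t) * r + t))).
  apply: continuous_clamp; first exact: continuous_tent.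
  by apply: continuous_mulr => //; exact: continuous_cst.
have cxi : continuous (fun q : 'rV[R]_3 => (q 0 i - (1 - t) * x0 -
    t * clamp (tent (q 0 (i + 1))) ((q 0 i - (1 - t) * x0) / ((1 - t) * r + t)))
    / ((1 - t) * r)).
  apply: continuous_mulr; last exact: continuous_cst.
  apply: continuous_subr => //; apply: continuous_mulr => //.
  exact: continuous_cst.
have cdiv (f : 'rV[R]_3 -> R) j : continuous f ->
    continuous (fun q : 'rV[R]_3 => (q 0 j - t * f q) / (1 - t)).
  move=> cf; apply: continuous_mulr; last exact: continuous_cst.
  apply: continuous_subr => //; apply: continuous_mulr => //.
  exact: continuous_cst.
apply: continuous_point; last 2 first.
- by apply: cdiv; exact: continuous_normr.
- by apply: cdiv; exact: continuous_cst.
apply: continuous_addr; first exact: continuous_cst.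
by apply: continuous_mulr => //; exact: continuous_cst.
Qed.

Lemma collapse_homeomorphism t : 0 <= t < 1 ->
  [/\ continuous (collapse t), continuous (uncollapse t),
      cancel (collapse t) (uncollapse t) & cancel (uncollapse t) (collapse t)].
Proof.
move=> t01; split; last exact: uncollapseK.
- exact: (continuous_pair_r t continuous_collapse).
- exact: continuous_uncollapse.
- exact: collapseK.
Qed.

End collapse.

(** * Piecewise affine maps and finite unions of segments *)

Section affine_on.
Variable R : realType.
Implicit Types (f g : R -> R) (a b c d : R).

Definition affine_on f a b :=
  exists u v, forall t, a <= t <= b -> f t = u + v * t.

(** The condition under which absolute values, maxima and minima of affine functions stay affine.
    The inequalities are weak, so that adjacent intervals can share an endpoint. *)
Definition sign_on f a b :=
  (forall t, a <= t <= b -> 0 <= f t) \/ (forall t, a <= t <= b -> f t <= 0).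

Lemma affine_on_sub f a b c d :
  a <= c -> d <= b -> affine_on f a b -> affine_on f c d.
Proof.
by move=> ac db [u [v fE]]; exists u, v => t tcd; apply: fE; lra.
Qed.

Lemma affine_on_cst a b c : affine_on (fun=> c) a b.
Proof. by exists c, 0 => t _; rewrite mul0r addr0. Qed.

Lemma affine_onD f g a b : affine_on f a b -> affine_on g a b ->
  affine_on (fun t => f t + g t) a b.
Proof.
move=> [u [v fE]] [u' [v' gE]]; exists (u + u'), (v + v') => t tab.
by rewrite fE // gE //; ring.
Qed.

Lemma affine_onZ f a b c : affine_on f a b -> affine_on (fun t => c * f t) a b.
Proof.
move=> [u [v fE]]; exists (c * u), (c * v) => t tab.
by rewrite fE //; ring.
Qed.

Lemma affine_onB f g a b : affine_on f a b -> affine_on g a b ->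
  affine_on (fun t => f t - g t) a b.
Proof.
move=> [u [v fE]] [u' [v' gE]]; exists (u - u'), (v - v') => t tab.
by rewrite fE // gE //; ring.
Qed.

Lemma eq_affine_on f g a b : (forall t, a <= t <= b -> f t = g t) ->
  affine_on f a b -> affine_on g a b.
Proof.
by move=> fg [u [v fE]]; exists u, v => t tab; rewrite -fg ?fE.
Qed.

Lemma affine_on_max f g a b : affine_on f a b -> affine_on g a b ->
  sign_on (fun t => f t - g t) a b ->
  affine_on (fun t => Num.max (f t) (g t)) a b.
Proof.
move=> af ag [fg|fg].
  by apply: eq_affine_on af => t /fg ?; rewrite max_l // -subr_ge0.
by apply: eq_affine_on ag => t /fg ?; rewrite max_r // -subr_le0.
Qed.

Lemma affine_on_min f g a b : affine_on f a b -> affine_on g a b ->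
  sign_on (fun t => f t - g t) a b ->
  affine_on (fun t => Num.min (f t) (g t)) a b.
Proof.
move=> af ag [fg|fg].
  by apply: eq_affine_on ag => t /fg ?; rewrite min_r // -subr_ge0.
by apply: eq_affine_on af => t /fg ?; rewrite min_l // -subr_le0.
Qed.

Lemma affine_on_norm f a b : affine_on f a b -> sign_on f a b ->
  affine_on (fun t => `|f t|) a b.
Proof.
move=> af [f0|f0].
  by apply: eq_affine_on af => t /f0 ?; rewrite ger0_norm.
by apply: eq_affine_on (affine_onZ (-1) af) => t /f0 ?; rewrite ler0_norm // mulN1r.
Qed.

Lemma sign_onN f a b : sign_on (fun t => - f t) a b -> sign_on f a b.
Proof.
by move=> [f0|f0]; [right|left] => t /f0; rewrite ?oppr_ge0 ?oppr_le0.
Qed.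

Lemma sign_on_sub f a b c d :
  a <= c -> d <= b -> sign_on f a b -> sign_on f c d.
Proof. by move=> ac db [f0|f0]; [left|right] => t tcd; apply: f0; lra. Qed.

(** A nonconstant affine function changes sign only at its zero, which serves as [c] if it lies
    inside the interval; otherwise the sign is already constant and [c = b] works. Negative slope
    reduces to positive slope by negation. *)
Lemma sign_on_split f a b : a <= b -> affine_on f a b ->
  exists2 c, a <= c <= b & sign_on f a c /\ sign_on f c b.
Proof.
move=> ab; have triv g : sign_on g a b ->
    exists2 c, a <= c <= b & sign_on g a c /\ sign_on g c b.
  by move=> sg; exists b; [rewrite ab lexx|split=> //; exact: sign_on_sub sg].
have pos g u v : 0 < v -> (forall t, a <= t <= b -> g t = u + v * t) ->
    exists2 c, a <= c <= b & sign_on g a c /\ sign_on g c b.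
  move=> v0 gE; pose z := - u / v.
  have {}gE t : a <= t <= b -> g t = v * (t - z).
    by move=> /gE ->; rewrite /z; field; exact: lt0r_neq0.
  have gp t : a <= t <= b -> z <= t -> 0 <= g t.
    by move=> /gE -> zt; rewrite mulr_ge0 ?subr_ge0 // ltW.
  have gn t : a <= t <= b -> t <= z -> g t <= 0.
    by move=> /gE -> zt; rewrite mulr_ge0_le0 ?subr_le0 // ltW.
  have [za|az] := leP z a; first by apply: triv; left=> t tab; apply: gp => //; lra.
  have [bz|zb] := leP b z; first by apply: triv; right=> t tab; apply: gn => //; lra.
  exists z; first by rewrite !ltW.
  by split; [right|left] => t tz; [apply: gn|apply: gp]; lra.
move=> [u [v fE]]; have [v0|v0|v0] := ltgtP v 0; last 1 first.
- apply: triv; have [u0|/ltW u0] := leP 0 u; [left|right] => t /fE ->;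
    by rewrite v0 mul0r addr0.
- have [||c cab [s1 s2]] := @pos (fun t => - f t) (- u) (- v).
  + by rewrite oppr_gt0.
  + by move=> t /fE ->; ring.
  by exists c => //; split; exact: sign_onN.
- exact: pos v0 fE.
Qed.

End affine_on.

Section polygonal_sets.
Variable R : realType.
Implicit Types (S : set 'rV[R]_3) (g : R -> 'rV[R]_3).

Definition segment_union S :=
  exists s : seq ('rV[R]_3 * 'rV[R]_3),
    S = \bigcup_(ab in [set` s]) segment ab.1 ab.2.

Lemma segment_unionU S S' :
  segment_union S -> segment_union S' -> segment_union (S `|` S').
Proof.
move=> [s ->] [s' ->]; exists (s ++ s'); rewrite -bigcup_setU; congr bigcup.
by apply/seteqP; split=> ab /=; rewrite mem_cat => /orP.
Qed.

Lemma segment_union_image (h : 'rV[R]_3 -> 'rV[R]_3) S :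
  (forall a b, segment_union (h @` segment a b)) ->
  segment_union S -> segment_union (h @` S).
Proof.
move=> hs [s ->]; elim: s => [|ab s IHs].
  by exists [::]; rewrite !bigcup_seq !big_nil image_set0.
rewrite bigcup_seq big_cons -bigcup_seq image_setU; exact: segment_unionU.
Qed.

Lemma segment_union_affine g a b : a <= b ->
  (forall j, affine_on (fun t => g t 0 j) a b) ->
  segment_union (g @` `[a, b]).
Proof.
move=> ab ag; exists [:: (g a, g b)].
have ga t : a <= t <= b -> forall s, t = (1 - s) * a + s * b ->
    g t = (1 - s) *: g a + s *: g b.
  move=> tab s ts; apply/rowP => j; have [u [v gE]] := ag j.
  by rewrite !mxE !gE ?lexx ?ab // ts; ring.
rewrite set_cons1 bigcup_set1 /=; apply/seteqP; split=> [_ [t + <-]|_ [t + <-]].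
(* For [a = b] this quotient is 0, as the inverse of 0 is 0, and it still gives the right point. *)
- rewrite /= in_itv /= => tab; exists ((t - a) / (b - a)).
    rewrite /= in_itv /=; have [->|ab'] := eqVneq a b.
      by rewrite subrr invr0 mulr0 lexx ler01.
    have ba0 : 0 < b - a by rewrite subr_gt0 lt_neqAle ab' ab.
    by rewrite divr_ge0 ?ler_pdivrMr //=; lra.
  apply/esym/ga => //; have [ab'|ab'] := eqVneq a b.
    by rewrite -ab' !subrr invr0 mulr0; lra.
  by field; rewrite subr_eq0 eq_sym.
- rewrite /= in_itv /= => /andP[t0 t1].
  have tab : a <= (1 - t) * a + t * b <= b by apply/andP; split; nra.
  by exists ((1 - t) * a + t * b); [rewrite /= in_itv|exact: ga].
Qed.

(** A reduction: to show that a path traces a finite union of segments, one may assume that a given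
    affine function has constant sign. It can be applied repeatedly on ever smaller intervals. *)
Lemma segment_union_split g f a b : a <= b -> affine_on f a b ->
  (forall c d, a <= c -> c <= d -> d <= b -> sign_on f c d ->
    segment_union (g @` `[c, d])) ->
  segment_union (g @` `[a, b]).
Proof.
move=> ab af H; have [c /andP[ac cb] [s1 s2]] := sign_on_split ab af.
have -> : `[a, b]%classic = `[a, c] `|` `[c, b].
  apply/seteqP; split=> t /=; rewrite !in_itv /=; last by lra.
  by move=> tab; case: (leP t c) => tc; [left|right]; lra.
by rewrite image_setU; apply: segment_unionU; apply: H.
Qed.

(** Along a segment only four operations fail to be affine: the absolute value of [xi], the maximum
    in [tent], and the minimum and the maximum in [clamp]. Cutting the interval for each of them,
    from the innermost outwards, makes every coordinate affine. The case [t = 1] is included and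
    later shows that the limit quadrilateral is polygonal. *)
Lemma collapse_segment i x0 r M t a b :
  segment_union (collapse i x0 r M t @` @segment R a b).
Proof.
rewrite /segment image_comp.
set g := _ \o _.
pose x j s := ((1 - s) *: a + s *: b) 0 j.
have ax j c d : affine_on (x j) c d.
  by exists (a 0 j), (b 0 j - a 0 j) => s _; rewrite /x !mxE; ring.
pose xi s := (x i s - x0) / r.
have axi c d : affine_on xi c d.
  by exists ((a 0 i - x0) / r), ((b 0 i - a 0 i) / r) => s _; rewrite /xi /x !mxE; ring.
apply: (segment_union_split ler01 (axi _ _)) => c d _ cd _ sxi.
pose y s := (1 - t) * x (i + 1) s + t * `|xi s|.
have ay : affine_on y c d.
  by apply: affine_onD; apply: affine_onZ => //; exact: affine_on_norm.
have a1y : affine_on (fun s => 1 - y s) c d.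
  by apply: affine_onB => //; exact: affine_on_cst.
have a01y : affine_on (fun s => 0 - (1 - y s)) c d.
  by apply: affine_onB => //; exact: affine_on_cst.
apply: (segment_union_split cd a01y) => {}c' d' cc' c'd' d'd s01y.
have {}ay := affine_on_sub cc' d'd ay; have {}a1y := affine_on_sub cc' d'd a1y.
have ah : affine_on (fun s => tent (y s)) c' d'.
  by apply: affine_on_max => //; exact: affine_on_cst.
apply: (segment_union_split c'd' (affine_onB ah (axi _ _))) => e f c'e ef fd' shxi.
have {}ay := affine_on_sub c'e fd' ay; have {}ah := affine_on_sub c'e fd' ah.
have am := affine_on_min ah (axi _ _) shxi.
have aNh : affine_on (fun s => - tent (y s)) e f.
  by apply: eq_affine_on (affine_onZ (-1) ah) => s _; rewrite mulN1r.
apply: (segment_union_split ef (affine_onB aNh am)) => k l ek kl lf sNhm.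
have {}ay := affine_on_sub ek lf ay.
have ac := affine_on_max (affine_on_sub ek lf aNh) (affine_on_sub ek lf am) sNhm.
apply: segment_union_affine => // j.
case: (ord3_cases i j) => ->; rewrite /g /collapse /=;
  under [X in affine_on X]eq_fun do rewrite point_coord.
- by apply: affine_onD; apply: affine_onZ => //; exact: ax.
- exact: ay.
- by apply: affine_onD; apply: affine_onZ; [exact: ax|exact: affine_on_cst].
Qed.

End polygonal_sets.

(** * Knots under homeomorphisms and the limit quadrilateral *)

Section knot_images.
Variable R : realType.
Implicit Types (S : set 'rV[R]_3) (h k : 'rV[R]_3 -> 'rV[R]_3).

Lemma within_continuous_precomp (T U V : topologicalType) (k : T -> U)
    (g : U -> V) (A : set T) (B : set U) :
  continuous k -> k @` A `<=` B -> {within B, continuous g} ->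
  {within A, continuous (g \o k)}.
Proof.
move=> ck kAB /subspace_continuousP cg; apply/subspace_continuousP => x Ax.
have Bkx : B (k x) by apply: kAB; exists x.
apply: (cvg_comp _ _ _ (cg _ Bkx)) => W BW.
have kW : nbhs x (k @^-1` (fun u => B u -> W u)) := ck x _ BW.
by apply: filterS kW => y kyW Ay; apply: kyW; apply: kAB; exists y.
Qed.

Lemma is_knot_image h k S : continuous h -> continuous k -> cancel h k ->
  is_knot S -> is_knot (h @` S).
Proof.
move=> ch ck hk [f [g [cf cg fS gS fK]]]; exists (h \o f), (g \o k).
have khS : k @` (h @` S) = S.
  by rewrite image_comp (_ : k \o h = id) ?image_id //; apply/funext.
split.
- by apply: within_continuous_comp => // x _; exact: ch.
- by apply: within_continuous_precomp cg; rewrite ?khS.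
- by rewrite -image_comp fS.
- by rewrite -image_comp khS.
- by move=> x Cx /=; rewrite hk fK.
Qed.

Lemma is_tame_knot_image h k S : continuous h -> continuous k ->
  cancel h k -> cancel k h -> is_tame_knot S -> is_tame_knot (h @` S).
Proof.
move=> ch ck hk kh [kS [u [[v [cu cv uT vT uv]] pu]]].
split; first exact: is_knot_image hk kS.
have kT : k @` setT = setT by apply/seteqP; split=> // x _; exists (h x).
have hT : h @` setT = setT by apply/seteqP; split=> // x _; exists (k x).
(* Undo [h], then apply the homeomorphism [u] that makes [S] polygonal. *)
exists (u \o k); split; last first.
  by rewrite image_comp (_ : (u \o k) \o h = u) //; apply/funext => x /=; rewrite hk.
exists (h \o v); split.
- exact: within_continuous_precomp cu.
- by apply: within_continuous_comp => // x _; exact: ch.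
- by rewrite -image_comp kT uT.
- by rewrite -image_comp vT hT.
- by move=> x _ /=; rewrite uv ?inE // kh.
Qed.

End knot_images.

Section diamond.
Variables (R : realType) (i : 'I_3) (M : R).

(** The limit of the deformation as a function of [xi]. As [xi] runs from -1 to 1, the first two
    coordinates run through (0, 1), (-1/2, 1/2), (0, 0), (1/2, 1/2) and back to (0, 1). *)
Definition diamond_param (xi : R) : 'rV[R]_3 :=
  point i (clamp (tent `|xi|) xi) `|xi| M.

Definition diamond_set : set 'rV[R]_3 :=
  [set p | `|p 0 i| + `|p 0 (i + 1) - 1 / 2| = 1 / 2 /\ p 0 (i + 2) = M].

Lemma continuous_diamond_param : continuous diamond_param.
Proof.
have cn : continuous (fun xi : R => `|xi|) by exact: norm_continuous.
apply: continuous_point => //; last exact: continuous_cst.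
by apply: continuous_clamp; [exact: continuous_tent|move=> ?; exact: cvg_id].
Qed.

Let norm_eq (x : R) : (0 <= x /\ `|x| = x) \/ (x <= 0 /\ `|x| = - x).
Proof.
have [x0|/ltW x0] := leP 0 x; [left|right]; split=> //.
  exact: ger0_norm.
exact: ler0_norm.
Qed.

Lemma diamond_paramE : diamond_param @` `[-1, 1] = diamond_set.
Proof.
apply/seteqP; split=> [_ [xi + <-]|p [pD pM]].
  rewrite /= in_itv /= => xi1; rewrite /diamond_set /= !point_coord; split=> //.
  have n1 : `|xi| <= 1 by rewrite ler_norml.
  have tE : tent `|xi| = 1 - `|xi| by rewrite /tent max_r //; lra.
  have := tent_ge0 `|xi|; rewrite tE => t0.
  case: (clampP xi t0) => *; rewrite ?normrN ?(ger0_norm t0);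
    case: (norm_eq xi) => -[? ?];
    by case: (norm_eq (`|xi| - 1 / 2)) => -[? ?]; lra.
pose y := p 0 (i + 1).
have [y0 y1] : 0 <= y /\ y <= 1.
  have := normr_ge0 (p 0 i); have := ler_norm (y - 1 / 2).
  by have := ler_norm (- (y - 1 / 2)); rewrite normrN; move: pD; rewrite -/y; lra.
(* The second coordinate prescribes the absolute value of [xi], and the first one its sign. *)
have [xi [nxi xi01 sx]] : exists xi, [/\ `|xi| = y, -1 <= xi <= 1 &
    (0 <= xi /\ 0 <= p 0 i) \/ (xi <= 0 /\ p 0 i <= 0)].
  have [x0|/ltW x0] := leP 0 (p 0 i).
    by exists y; rewrite ger0_norm //; split; [lra..|left].
  by exists (- y); rewrite normrN ger0_norm //; split; [lra..|right; lra].
exists xi; first by rewrite /= in_itv.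
apply: (coord_ext (i := i)); rewrite point_coord //.
rewrite nxi (_ : tent y = 1 - y); last by rewrite /tent max_r //; lra.
move: pD; rewrite -/y.
have t0 : 0 <= 1 - y by lra.
case: (clampP xi t0) => *; case: (norm_eq (p 0 i)) => -[? ?];
  case: (norm_eq (y - 1 / 2)) => -[? ?];
  by case: (norm_eq xi) => -[? ?]; case: sx => -[? ?]; lra.
Qed.

(* The lower bounds 1 and 1 / 8 hold automatically on the circle and on the
   diamond; they only make both maps continuous everywhere. *)
Definition circle_to_diamond (q : R * R) : 'rV[R]_3 :=
  let n := Num.max 1 (`|q.1| + `|q.2|) in
  point i (q.1 / (2 * n)) (1 / 2 + q.2 / (2 * n)) M.

Definition diamond_to_circle (p : 'rV[R]_3) : R * R :=
  let a := p 0 i in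
  let b := p 0 (i + 1) - 1 / 2 in
  let rho := Num.sqrt (Num.max (1 / 8) (a * a + b * b)) in
  (a / rho, b / rho).

Lemma continuous_circle_to_diamond : continuous circle_to_diamond.
Proof.
have c1 : continuous (fun q : R * R => q.1) by move=> ?; exact: cvg_fst.
have c2 : continuous (fun q : R * R => q.2) by move=> ?; exact: cvg_snd.
have cn : continuous (fun q : R * R => (2 * Num.max 1 (`|q.1| + `|q.2|))^-1).
  apply: continuous_invr.
    apply: continuous_mulr; first exact: continuous_cst.
    apply: continuous_maxr; first exact: continuous_cst.
    by apply: continuous_addr; exact: continuous_normr.
  by move=> q; rewrite mulf_neq0 // lt0r_neq0 // lt_max ltr01.
apply: continuous_point; last exact: continuous_cst.
  exact: continuous_mulr.
by apply: continuous_addr; [exact: continuous_cst|exact: continuous_mulr].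
Qed.

Lemma continuous_diamond_to_circle : continuous diamond_to_circle.
Proof.
have ca : continuous (fun p : 'rV[R]_3 => p 0 i) by exact: continuous_coord.
have cb : continuous (fun p : 'rV[R]_3 => p 0 (i + 1) - 1 / 2).
  by apply: continuous_subr; [exact: continuous_coord|exact: continuous_cst].
have cr : continuous (fun p : 'rV[R]_3 => (Num.sqrt (Num.max (1 / 8)
    (p 0 i * p 0 i + (p 0 (i + 1) - 1 / 2) * (p 0 (i + 1) - 1 / 2))))^-1).
  apply: continuous_invr.
    move=> p; apply: continuous_comp; last exact: sqrt_continuous.
    apply: continuous_maxr; first exact: continuous_cst.
    by apply: continuous_addr; exact: continuous_mulr.
  by move=> p; rewrite lt0r_neq0 // sqrtr_gt0 lt_max; apply/orP; left; lra.
exact: continuous_pairr (continuous_mulr ca cr) (continuous_mulr cb cr).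
Qed.

(** The diamond is a circle of radius 1/2 for the l1 norm; central projection matches it with the
    Euclidean circle. *)
Lemma is_knot_diamond : is_knot diamond_set.
Proof.
have n_ge1 (q : R * R) : circle q -> 1 <= `|q.1| + `|q.2|.
  move=> qC; have a0 := normr_ge0 q.1; have b0 := normr_ge0 q.2.
  rewrite -(@ler_pXn2r _ 2) ?nnegrE ?addr_ge0 // expr1n -[leLHS]qC.
  rewrite -(real_normK (num_real q.1)) -(real_normK (num_real q.2)).
  by have := mulr_ge0 a0 b0; lra.
have d_ge8 p : diamond_set p ->
    1 / 8 <= p 0 i * p 0 i + (p 0 (i + 1) - 1 / 2) * (p 0 (i + 1) - 1 / 2).
  move=> [pD _]; move: pD; set a := p 0 i; set b := p 0 (i + 1) - 1 / 2 => pD.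
  have -> : a * a = `|a| ^+ 2 by rewrite real_normK ?num_real.
  have -> : b * b = `|b| ^+ 2 by rewrite real_normK ?num_real.
  have -> : `|b| = 1 / 2 - `|a| by lra.
  (* The sum of squares equals 1/8 plus twice the square of [|a| - 1 / 4]. *)
  by have := sqr_ge0 (`|a| - 1 / 4); nra.
have fD q : circle q -> diamond_set (circle_to_diamond q).
  move=> /n_ge1 n1; rewrite /diamond_set /circle_to_diamond /= !point_coord.
  rewrite max_r //; split=> //; set n := `|q.1| + `|q.2| in n1 *.
  have n0 : 0 < 2 * n by lra.
  rewrite (addrC (1 / 2)) addrK !normrM normfV (gtr0_norm n0) -mulrDl -/n.
  by field; rewrite lt0r_neq0 //; lra.
have gC p : diamond_set p -> circle (diamond_to_circle p).
  move=> /d_ge8 d8; rewrite /circle /diamond_to_circle /= max_r //.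
  set d := _ + _ in d8 *.
  have d0 : 0 < d by apply: lt_le_trans d8; lra.
  rewrite !expr_div_n -mulrDl sqr_sqrtr ?ltW // !expr2 -/d.
  by rewrite divff // lt0r_neq0.
have fK q : circle q -> diamond_to_circle (circle_to_diamond q) = q.
  move=> qC; have n1 := n_ge1 q qC; have := d_ge8 _ (fD q qC).
  rewrite /diamond_to_circle /circle_to_diamond /= !point_coord max_r //.
  set n := `|q.1| + `|q.2| in n1 *; have n0 : n != 0 by rewrite lt0r_neq0 //; lra.
  have -> : 1 / 2 + q.2 / (2 * n) - 1 / 2 = q.2 / (2 * n) by ring.
  have -> : q.1 / (2 * n) * (q.1 / (2 * n)) + q.2 / (2 * n) * (q.2 / (2 * n))
      = (1 / (2 * n)) ^+ 2.
    by transitivity ((q.1 ^+ 2 + q.2 ^+ 2) / (2 * n) ^+ 2); [|rewrite qC]; field.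
  move=> d8; rewrite max_r // sqrtr_sqr ger0_norm; last by rewrite divr_ge0 //; lra.
  by rewrite [RHS]surjective_pairing; congr (_, _); field.
have gK p : diamond_set p -> circle_to_diamond (diamond_to_circle p) = p.
  move=> pD; have := n_ge1 _ (gC p pD); have d8 := d_ge8 p pD.
  rewrite /diamond_to_circle /circle_to_diamond /= (max_r d8).
  case: pD; set a := p 0 i; set b := p 0 (i + 1) - 1 / 2 => pD pM.
  set rho := Num.sqrt _; have rho0 : 0 < rho.
    by rewrite sqrtr_gt0; apply: lt_le_trans d8; lra.
  have rho_neq0 := lt0r_neq0 rho0.
  rewrite !normrM normfV (gtr0_norm rho0) -mulrDl pD => n1.
  rewrite max_r //; apply: (coord_ext (i := i)); rewrite point_coord //.
    by rewrite -/a; field.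
  by transitivity (1 / 2 + b); [field|rewrite /b; ring].
exists circle_to_diamond, diamond_to_circle; split.
- exact: continuous_subspaceT continuous_circle_to_diamond.
- exact: continuous_subspaceT continuous_diamond_to_circle.
- apply/seteqP; split=> [_ [q /fD ? <-] //|p pD].
  by exists (diamond_to_circle p); [exact: gC|exact: gK].
- apply/seteqP; split=> [_ [p /gC ? <-] //|q qC].
  by exists (circle_to_diamond q); [exact: fD|exact: fK].
- by move=> q /set_mem; exact: fK.
Qed.

End diamond.

(** * Deforming knots *)

Section deformation.
Variable R : realType.

Lemma interval_nonempty : (`[-1, 1] : set R) !=set0.
Proof. by exists 0; rewrite /= in_itv /=; lra. Qed.

Lemma interval_connected : connected (`[-1, 1] : set R).
Proof. by apply/connected_intervalP; exact: interval_is_interval. Qed.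

Definition interval_continuum : continuum R :=
  Continuum interval_nonempty (@segment_compact R (-1) 1) interval_connected.

Definition diamond (i : 'I_3) (M : R) : continuum 'rV[R]_3 :=
  image_continuum (continuous_diamond_param (i := i) (M := M)) interval_continuum.

Lemma diamondE i M : diamond i M = diamond_set i M :> set _.
Proof. exact: diamond_paramE. Qed.

Lemma collapse1 i x0 r M (p : 'rV[R]_3) :
  collapse i x0 r M 1 p = diamond_param i M (rescale i x0 r p).
Proof. by rewrite /collapse subrr !mul0r !add0r !mul1r. Qed.

Lemma coord_max (C : continuum 'rV[R]_3) j :
  exists2 p, carrier C p & forall q, carrier C q -> q 0 j <= p 0 j.
Proof.
have [|||p /set_mem Cp pmax] := @compact_EVT_max _ R (fun p : 'rV[R]_3 => p 0 j) C.
- exact: continuum_nonempty.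
- exact: continuum_compact.
- by apply: continuous_subspaceT; exact: continuous_coord.
by exists p => // q Cq; apply: pmax; rewrite inE.
Qed.

Lemma coord_min (C : continuum 'rV[R]_3) j :
  exists2 p, carrier C p & forall q, carrier C q -> p 0 j <= q 0 j.
Proof.
have [|||p /set_mem Cp pmin] := @compact_EVT_min _ R (fun p : 'rV[R]_3 => p 0 j) C.
- exact: continuum_nonempty.
- exact: continuum_compact.
- by apply: continuous_subspaceT; exact: continuous_coord.
by exists p => // q Cq; apply: pmin; rewrite inE.
Qed.

(** At time 1 only the rescaled coordinate matters. It stays in [-1, 1] on [C], attains both ends at
    [a] and [b], and takes all values between them because [C] is connected. *)
Lemma collapse1_diamond (C : continuum 'rV[R]_3) i M a b :
  carrier C a -> carrier C b -> a 0 i < b 0 i ->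
  (forall q, carrier C q -> a 0 i <= q 0 i <= b 0 i) ->
  collapse i ((a 0 i + b 0 i) / 2) ((b 0 i - a 0 i) / 2) M 1 @` C
    = diamond i M.
Proof.
move=> Ca Cb ab Cab; set x0 := (_ + _) / 2; set r := (_ - _) / 2.
have r0 : 0 < r by rewrite /r; lra.
rewrite /= (_ : collapse _ _ _ _ _ = diamond_param i M \o rescale i x0 r); last first.
  by apply/funext => p; exact: collapse1.
rewrite -image_comp; congr image; apply/seteqP; split=> [_ [p /Cab pab <-]|xi].
  by rewrite /= in_itv /= /rescale ler_pdivlMr // ler_pdivrMr // /x0 /r; lra.
rewrite /= in_itv /= => xi1.
have : is_interval ((fun p : 'rV[R]_3 => p 0 i) @` C).
  apply/connected_intervalP; apply: connected_continuous_connected.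
    exact: continuum_connected.
  by apply: continuous_subspaceT; exact: continuous_coord.
move=> /(_ (a 0 i) (b 0 i) (ex_intro2 _ _ _ Ca erefl) (ex_intro2 _ _ _ Cb erefl)
  (x0 + r * xi)) [|p Cp pE].
  have : r * -1 <= r * xi by rewrite ler_pM2l //; lra.
  have : r * xi <= r * 1 by rewrite ler_pM2l //; lra.
  by rewrite /x0 /r; lra.
by exists p => //; rewrite /rescale pE; field; exact: lt0r_neq0.
Qed.

End deformation.

(** * Arcwise connectedness of a class of knots stable under the deformation *)

Section knot_classes.
Variables (R : realType) (P : set 'rV[R]_3 -> Prop).
Hypothesis P_knot : forall S, P S -> is_knot S.
Hypothesis P_collapse : forall i x0 r M t S,
  0 < r -> 0 <= t < 1 -> P S -> P (collapse i x0 r M t @` S).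
Hypothesis P_diamond : forall i M, P (diamond_set i M).

Let A := [set C : continuum 'rV[R]_3 | P C].

(* Injectivity in time: the maximum of the last coordinate moves affinely from
   its initial value to M. *)
Lemma arc_joined_diamond (C : continuum 'rV[R]_3) i M m a b : P C ->
  carrier C a -> carrier C b -> a 0 i <> b 0 i ->
  carrier C m -> (forall p, carrier C p -> p 0 (i + 2) <= m 0 (i + 2)) ->
  m 0 (i + 2) <> M -> arc_joined R A C (diamond i M).
Proof.
move=> PC Ca Cb ab Cm mmax mM.
(* Replace the two given points by points of [C] with extreme coordinate [i], so that the rescaled
   coordinate fills exactly [-1, 1]. *)
have {a b Ca Cb ab}[a [b [Ca Cb ab Cab]]] : exists a b, [/\ carrier C a, carrier C b,
    a 0 i < b 0 i & forall q, carrier C q -> a 0 i <= q 0 i <= b 0 i].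
  have [a' Ca' amin] := coord_min C i; have [b' Cb' bmax] := coord_max C i.
  exists a', b'; split => //; last by move=> q Cq; rewrite amin ?bmax.
  have := amin _ Ca; have := bmax _ Ca; have := amin _ Cb; have := bmax _ Cb.
  by move/eqP: ab; rewrite neq_lt => /orP[]; lra.
set x0 := (a 0 i + b 0 i) / 2; set r := (b 0 i - a 0 i) / 2.
have r0 : 0 < r by rewrite /r; lra.
have cF := @continuous_collapse R i x0 r M.
right; exists (fun t => image_continuum (continuous_pair_r t cF) C); split.
- exact: vietoris_continuous.
- move=> s t; rewrite !inE /= !in_itv /= => s01 t01 /(congr1 (@carrier _)) /= st.
  have le u v : 0 <= u <= 1 -> 0 <= v <= 1 ->
      collapse i x0 r M u @` C = collapse i x0 r M v @` C ->
      (1 - u) * m 0 (i + 2) + u * M <= (1 - v) * m 0 (i + 2) + v * M.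
    (* The image at time [u] of the highest point [m] is also the image at time [v] of some [p],
       which is no higher than [m]. *)
    move=> u01 v01 uv; have : (collapse i x0 r M u @` C) (collapse i x0 r M u m).
      by exists m.
    rewrite uv => -[p Cp /(congr1 (fun q : 'rV[R]_3 => q 0 (i + 2)))].
    rewrite /collapse !point_coord => <-; rewrite lerD2r ler_wpM2l ?mmax //; lra.
  have /eqP : (s - t) * (M - m 0 (i + 2)) = 0.
    by have := le s t s01 t01 st; have := le t s t01 s01 (esym st); lra.
  rewrite mulf_eq0 !subr_eq0 => /orP[/eqP //|/eqP Mm].
  by case: mM.
- move=> _ [t + <-]; rewrite /= in_itv /= => /andP[t0 t1].
  rewrite /A /=; have [t1'|/eqP ->] : t < 1 \/ t == 1.
    by move: t1; rewrite le_eqVlt => /orP[]; [right|left].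
  + by apply: P_collapse => //; rewrite t0.
  + by rewrite (collapse1_diamond _ Ca Cb ab Cab) diamondE.
- apply: carrier_inj => /=; rewrite (_ : (fun t => _) = id) ?image_id //.
  by apply/funext => p; exact: collapse0.
- by apply: carrier_inj; exact: collapse1_diamond.
Qed.

(** Collapsing along the axis [i + 1] is possible since the diamond extends from 0 to 1 in that
    direction. The height coordinate is then [i + 1 + 2 = i], whose maximum 1/2 on the diamond
    differs from the target height 0. *)
Lemma diamond_next i M : arc_joined R A (diamond i M) (diamond (i + 1) 0).
Proof.
have mem xi : -1 <= xi <= 1 -> carrier (diamond i M) (diamond_param i M xi).
  by move=> xi1; exists xi; rewrite //= in_itv.
have i3 : i + 1 + 2 = i.
  by rewrite -addrA -[RHS]addr0; congr (_ + _); exact: val_inj.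
have clE xi : 0 <= xi <= 1 -> clamp (tent `|xi|) xi = Num.min xi (1 - xi).
  move=> xi1; rewrite ger0_norm; last by lra.
  have -> : tent xi = 1 - xi by rewrite /tent max_r //; lra.
  by case: clampP => *; case: (leP xi (1 - xi)) => *; lra.
(* The parameter 1/2 gives the vertex with the largest coordinate [i]; the parameters 0 and 1 give
   the values 0 and 1 of coordinate [i + 1]. *)
apply: (@arc_joined_diamond _ _ _ (diamond_param i M (1 / 2))
  (diamond_param i M 0) (diamond_param i M 1)).
- by rewrite diamondE; exact: P_diamond.
- by apply: mem; lra.
- by apply: mem; lra.
- by rewrite !point_coord normr0 normr1; move/eqP; rewrite eq_sym oner_eq0.
- by apply: mem; lra.
- rewrite diamondE i3 => p [pD _]; rewrite point_coord clE; last by lra.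
  rewrite min_l; last by lra.
  by have := normr_ge0 (p 0 (i + 1) - 1 / 2); have := ler_norm (p 0 i); lra.
- rewrite i3 point_coord clE; last by lra.
  by rewrite min_l; lra.
Qed.

Lemma hausdorff_continuum : hausdorff_space (continuum 'rV[R]_3).
Proof.
apply: vietoris_hausdorff; [exact: norm_hausdorff|exact: uniform_regular].
Qed.

Let trans := arc_joined_trans (R := R) (A := A) hausdorff_continuum.

(** Each application of [diamond_next] advances the axis cyclically and resets the height to 0, so
    at most three of them lead to [diamond 0 0]. *)
Lemma arc_joined_diamond0 i M : arc_joined R A (diamond i M) (diamond 0 0).
Proof.
have next1 := diamond_next.
have d20 N : arc_joined R A (diamond 2 N) (diamond 0 0).
  by rewrite [X in diamond X 0](_ : _ = 2 + 1) //; apply: val_inj.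
have d10 N : arc_joined R A (diamond 1 N) (diamond 0 0).
  apply: trans (d20 0); rewrite [X in diamond X 0](_ : _ = 1 + 1) //.
have d00 N : arc_joined R A (diamond 0 N) (diamond 0 0).
  apply: trans (d10 0); rewrite [X in diamond X 0](_ : _ = 0 + 1) //.
  by rewrite add0r.
by case: (ord3_cases 0 i) => ->; rewrite ?add0r.
Qed.

Lemma is_knot_two_points S :
  is_knot S -> exists p q : 'rV[R]_3, [/\ S p, S q & p <> q].
Proof.
move=> [f [g [_ _ fS _ fK]]].
have c1 : circle (1 : R, 0 : R) by rewrite /circle /= expr1n expr0n addr0.
have c2 : circle (0 : R, 1 : R) by rewrite /circle /= expr1n expr0n add0r.
exists (f (1, 0)), (f (0, 1)); split; rewrite -?fS; [by exists (1, 0)|by exists (0, 1)|].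
move=> /(congr1 g); by rewrite !fK ?inE // => -[/eqP]; rewrite oner_eq0.
Qed.

Lemma knot_class_arcwise_connected : arcwise_connected R A.
Proof.
apply: (arc_joined_connected hausdorff_continuum).
have base C : A C -> arc_joined R A C (diamond 0 0).
  move=> PC; have [p [q [Cp Cq pq]]] := is_knot_two_points (P_knot PC).
  have [i pqi] : exists i, p 0 i <> q 0 i.
    apply: contrapT => /forallNP H; apply: pq; apply/rowP => i.
    exact: contrapT (H i).
  have [m Cm mmax] := coord_max C (i + 2).
  (* The target height exceeds the maximum on [C] by 1, hence differs from it, as injectivity of the
     path requires. *)
  apply: trans (arc_joined_diamond0 i (m 0 (i + 2) + 1)).
  by apply: (arc_joined_diamond PC Cp Cq pqi Cm mmax); lra.
by move=> C D PC PD; apply: trans (base C PC) _; apply: arc_joined_sym; exact: base.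
Qed.

End knot_classes.

(** The diamond is itself the collapse at time 1 of one straight segment, on which the rescaled
    coordinate runs from -1 to 1. *)
Lemma is_polygonal_knot_diamond (R : realType) i (M : R) :
  is_polygonal_knot (diamond_set i M).
Proof.
split; first exact: is_knot_diamond.
have -> : diamond_set i M =
    collapse i 0 1 M 1 @` segment (point i (-1) 0 0) (point i 1 0 0).
  rewrite -diamond_paramE /segment image_comp.
  have gE t : (collapse i 0 1 M 1 \o (fun t => (1 - t) *: point i (-1) 0 0
      + t *: point i 1 0 0)) t = diamond_param i M (2 * t - 1).
    rewrite /= collapse1 /rescale; congr diamond_param.
    have sE (p q : 'rV[R]_3) : ((1 - t) *: p + t *: q) 0 i =
      (1 - t) * p 0 i + t * q 0 i by rewrite !mxE.
    by rewrite sE !point_coord; field.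
  apply/seteqP; split=> [_ [xi + <-]|_ [t + <-]]; rewrite /= in_itv /= => H.
    exists ((xi + 1) / 2); first by rewrite /= in_itv /=; lra.
    by apply: etrans (gE _) _; congr diamond_param; field.
  by exists (2 * t - 1); [rewrite /= in_itv /=; lra|exact: esym (gE t)].
exact: collapse_segment.
Qed.

Theorem proposition2p4 (R : realType) :
  [/\ arcwise_connected R (knots R),
      arcwise_connected R (polygonal_knots R) &
      arcwise_connected R (tame_knots R)].
Proof.
have knotC i (x0 r M t : R) S : 0 < r -> 0 <= t < 1 -> is_knot S ->
    is_knot (collapse i x0 r M t @` S).
  move=> r0 t01; have [ch ck hk kh] := collapse_homeomorphism i x0 M r0 t01.
  exact: is_knot_image hk.
split.
- apply: (@knot_class_arcwise_connected R (@is_knot R)) => //.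
  exact: is_knot_diamond.
- apply: (@knot_class_arcwise_connected R (@is_polygonal_knot R)).
  + by move=> S [].
  + move=> i x0 r M t S r0 t01 [kS sS]; split; first exact: knotC.
    by apply: segment_union_image sS => a b; exact: collapse_segment.
  + exact: is_polygonal_knot_diamond.
- apply: (@knot_class_arcwise_connected R (@is_tame_knot R)).
  + by move=> S [].
  + move=> i x0 r M t S r0 t01.
    have [ch ck hk kh] := collapse_homeomorphism i x0 M r0 t01.
    exact: is_tame_knot_image hk kh.
  + move=> i M; split; first exact: is_knot_diamond.
    (* The diamond is already polygonal, so the identity shows that it is tame. *)
    exists id; split; last by rewrite image_id; exact: is_polygonal_knot_diamond.
    exists id; split; rewrite ?image_id //;
      by apply: continuous_subspaceT => x; exact: cvg_id.
Qed.
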